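(* Let $I$ be a double interval and suppose that $f$ is a double function such that $I\subseteq D(f)$. Then $f$ is double continuous on $I$ if and only if $f$ is globally double continuous on $I$.
   Context: Points of $\mathbb{R}^2$ are written $a=(a_1,a_2)$. A double function is a real-valued function $f$ with domain $D(f)\subseteq\mathbb{R}^2$. A double interval is a set $I=I_1\times I_2$ with $I_1,I_2$ nondegenerate intervals in $\mathbb{R}$ (open, closed, half-open, bounded or not). The double difference is $\Delta_a^b(f)=f(b_1,b_2)-f(b_1,a_2)-f(a_1,b_2)+f(a_1,a_2)$. Double continuity at a point: $f$ is double continuous at $a$ if there is a product $J=J_1\times J_2$ of open intervals with $a\in J\subseteq D(f)$ such that for all $x_1\in J_1$, $\lim_{x_2\to a_2}\Delta_a^{x}(f)=0$, and for all $x_2\in J_2$, $\lim_{x_1\to a_1}\Delta_a^{x}(f)=0$, where $x=(x_1,x_2)$. Signed double continuity: for $\delta=(\delta_1,\delta_2)$ with $\delta_1,\delta_2>0$, let $D_{++}(a,\delta)=[a_1,a_1+\delta_1)\times[a_2,a_2+\delta_2)$, $D_{+-}(a,\delta)=[a_1,a_1+\delta_1)\times(a_2-\delta_2,a_2]$, $D_{-+}(a,\delta)=(a_1-\delta_1,a_1]\times[a_2,a_2+\delta_2)$, $D_{--}(a,\delta)=(a_1-\delta_1,a_1]\times(a_2-\delta_2,a_2]$. For signs $\sigma,\tau\in\{+,-\}$, $f$ is $\sigma\tau$-double continuous at $a$ if there is such a $\delta$ with $J:=D_{\sigma\tau}(a,\delta)\subseteq D(f)$ such that for all $x_1\in J_1$,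 $\lim_{x_2\to a_2^{\tau}}\Delta_a^x(f)=0$ and for all $x_2\in J_2$, $\lim_{x_1\to a_1^{\sigma}}\Delta_a^x(f)=0$ (one-sided limits). $f$ is double continuous on $I$ if it is double continuous at each interior point of $I$ and, at each boundary point $p\in I$, it is $\sigma\tau$-double continuous for every sign pair $\sigma\tau$ such that $D_{\sigma\tau}(p,\delta)\subseteq I$ for some $\delta$. $f$ is globally double continuous on $I$ if: for all $c,d\in I_1$ and all $e\in I_2$, $\lim_{x_2\to e;\,x_2\in I_2}\Delta_{(d,e)}^{(c,x_2)}(f)=0$; and for all $c,d\in I_2$ and all $e\in I_1$, $\lim_{x_1\to e;\,x_1\in I_1}\Delta_{(e,d)}^{(x_1,c)}(f)=0$. *)

(* Defs.v *)
From mathcomp Require Import all_boot all_order all_algebra.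
From mathcomp Require Import all_classical all_reals all_analysis.
Import Order.TTheory GRing.Theory Num.Theory.
Import numFieldNormedType.Exports.

Set Implicit Arguments.
Unset Strict Implicit.
Unset Printing Implicit Defensive.

Local Open Scope classical_set_scope.
Local Open Scope ring_scope.

(* A partial function R^2 -> R, encoded as a total function together with its
   domain. The values outside the domain are junk: the notions below constrain
   f only at points of its domain (in a limit, only near the limit point). *)
Record double_function (R : realType) := DoubleFunction {
  dom : set (R * R);
  dfun :> R * R -> R }.

Definition ddiff (R : realType) (f : R * R -> R) (a b : R * R) : R :=
  f (b.1, b.2) - f (b.1, a.2) - f (a.1, b.2) + f (a.1, a.2).

Definition nondegenerate_interval (R : realType) (A : set R) : Prop :=
  is_interval A /\ exists x y, [/\ A x, A y & x < y].

(* Bounded or not; also holds of the empty set, which is excluded below since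
   a.1 and a.2 have to be members. *)
Definition open_interval (R : realType) (A : set R) : Prop :=
  is_interval A /\ open A.

(* x^' is the punctured neighborhood filter of x. *)
Definition double_continuous_at (R : realType) (f : double_function R)
    (a : R * R) : Prop :=
  exists J1 J2 : set R,
    [/\ open_interval J1, open_interval J2, (J1 `*` J2) a
      & J1 `*` J2 `<=` dom f] /\
    (forall x1, J1 x1 -> ddiff f a (x1, x2) @[x2 --> a.2^'] --> (0 : R)) /\
    (forall x2, J2 x2 -> ddiff f a (x1, x2) @[x1 --> a.1^'] --> (0 : R)).

Inductive sign := Plus | Minus.

Definition half_nbhd (R : realType) (s : sign) (x d : R) : set R :=
  match s with
  | Plus => `[x, x + d[
  | Minus => `]x - d, x]
  end.

Definition at_side (R : realType) (s : sign) (x : R) : set_system R :=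
  match s with
  | Plus => x^'+
  | Minus => x^'-
  end.

Definition quadrant (R : realType) (s t : sign) (a d : R * R) : set (R * R) :=
  half_nbhd s a.1 d.1 `*` half_nbhd t a.2 d.2.

Definition signed_double_continuous_at (R : realType) (s t : sign)
    (f : double_function R) (a : R * R) : Prop :=
  exists d : R * R,
    [/\ 0 < d.1, 0 < d.2 & quadrant s t a d `<=` dom f] /\
    (forall x1, half_nbhd s a.1 d.1 x1 ->
      ddiff f a (x1, x2) @[x2 --> at_side t a.2] --> (0 : R)) /\
    (forall x2, half_nbhd t a.2 d.2 x2 ->
      ddiff f a (x1, x2) @[x1 --> at_side s a.1] --> (0 : R)).

Definition double_continuous_on (R : realType) (I : set (R * R))
    (f : double_function R) : Prop :=
  (forall p, interior I p -> double_continuous_at f p) /\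
  (forall p, I p -> (closure I `\` interior I) p ->
    forall s t : sign,
      (exists d : R * R, [/\ 0 < d.1, 0 < d.2 & quadrant s t p d `<=` I]) ->
      signed_double_continuous_at s t f p).

Definition globally_double_continuous_on (R : realType) (I1 I2 : set R)
    (f : double_function R) : Prop :=
  (forall c d e, I1 c -> I1 d -> I2 e ->
    ddiff f (d, e) (c, x2) @[x2 --> within I2 e^'] --> (0 : R)) /\
  (forall c d e, I2 c -> I2 d -> I1 e ->
    ddiff f (e, d) (x1, c) @[x1 --> within I1 e^'] --> (0 : R)).

(* Main.v *)
(* For fixed [e], the relation "[ddiff f (c, e) (d, y) --> 0] as [y --> e]
   from one side" is an equivalence relation between abscissae [c] and [d],
   because double differences are additive in [(c, d)]. Double continuity makes
   its classes relatively open in the interval [I1], so by completeness of the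
   reals there is only one class, which is global double continuity. *)

Require Import Defs.
From mathcomp Require Import all_boot all_order all_algebra.
From mathcomp Require Import all_classical all_reals all_analysis.
From mathcomp Require Import ring lra.
Import Order.TTheory GRing.Theory Num.Theory.
Import numFieldNormedType.Exports.

Local Open Scope classical_set_scope.
Local Open Scope ring_scope.

Lemma dnbhs_within (T : topologicalType) (x : T) (A : set T) :
  nbhs x A -> x^' `=>` within A x^'.
Proof.
move=> xA P PA; rewrite /dnbhs /within /= in PA *.
by apply: filterS2 xA PA => y Ay AP /AP; exact.
Qed.

Section Sides.
Context {R : realType}.
Implicit Types (s t : sign) (x y d e : R) (A : set R).

Lemma half_nbhd_center s x d : 0 < d -> half_nbhd s x d x.
Proof. by move=> d0; case: s => /=; rewrite in_itv /=; apply/andP; split; lra. Qed.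

Lemma half_nbhd_ball s x d : half_nbhd s x d `<=` ball x d.
Proof.
move=> y; rewrite /ball /= ltr_distlC.
by case: s => /=; rewrite in_itv /= => /andP[? ?]; apply/andP; split; lra.
Qed.

#[global] Instance at_side_filter s x : Filter (at_side s x).
Proof. by case: s; exact: within_filter. Qed.

Lemma at_side_half_nbhd s x d :
  0 < d -> \forall y \near at_side s x, half_nbhd s x d y.
Proof.
move=> d0; case: s => /=.
  near=> y; rewrite /= in_itv /=; apply/andP; split.
    by near: y; exact: nbhs_right_ge.
  by near: y; apply: nbhs_right_lt; lra.
near=> y; rewrite /= in_itv /=; apply/andP; split; last first.
  by near: y; exact: nbhs_left_le.
by near: y; apply: nbhs_left_gt; lra.
Unshelve. all: by end_near. Qed.

Lemma at_side_dnbhs s x : at_side s x `=>` x^'.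
Proof.
move=> P; case: s => /=; rewrite /at_right /at_left /dnbhs /within /=.
  by apply: filterS => y Py xy; apply: Py; rewrite gt_eqF.
by apply: filterS => y Py xy; apply: Py; rewrite lt_eqF.
Qed.

Lemma at_side_within s x d A : 0 < d -> half_nbhd s x d `<=` A ->
  at_side s x `=>` within A x^'.
Proof.
move=> d0 dA P /at_side_dnbhs; move/(_ s) => PA.
apply: filterS2 PA (at_side_half_nbhd s x d d0) => y AP yd.
exact/AP/dA.
Qed.

(** Splits a limit along [A] into one-sided statements, required only on the sides where [A]
    contains a half-neighborhood of [x]. These are the only sides on which double continuity gives
    information. *)
Lemma within_dnbhs_sides A x (P : set R) : is_interval A -> A x ->
  (forall s d, 0 < d -> half_nbhd s x d `<=` A -> at_side s x P) ->
  within A x^' P.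
Proof.
move=> iA Ax H.
have side s : at_side s x [set y | A y -> P y].
  have [[d d0 dA]|nd] := pselect (exists2 d, 0 < d & half_nbhd s x d `<=` A).
    by apply: filterS (H s d d0 dA) => y Py _.
  (* No half-neighborhood fits in [A] on this side. A point [y] of [A] strictly on this side would
     yield one, of length the distance from [x] to [y], by convexity. So the claim is vacuous
     here. *)
  case: s nd => /= nd.
    apply: filterS (nbhs_right_gt x) => y /= xy Ay; case: nd.
    exists (y - x); first by rewrite subr_gt0.
    move=> z /=; rewrite in_itv /= => /andP[? ?].
    by apply: (iA _ _ Ax Ay); apply/andP; split; lra.
  apply: filterS (nbhs_left_lt x) => y /= xy Ay; case: nd.
  exists (x - y); first by rewrite subr_gt0.
  move=> z /=; rewrite in_itv /= => /andP[? ?].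
  by apply: (iA _ _ Ay Ax); apply/andP; split; lra.
have := side Minus; have := side Plus; rewrite /= /at_left /at_right /dnbhs /within /=.
apply: filterS2 => y Pp Pm; rewrite neq_lt => /orP[yx|xy]; first exact: Pm.
exact: Pp.
Qed.

(* The supremum of the points of [[a, b]] related to [a] is again related to
   [a], and cannot be smaller than [b]. *)
Lemma interval_one_class A (r : R -> R -> Prop) : is_interval A ->
  (forall x, r x x) -> (forall x y, r x y -> r y x) ->
  (forall x y z, r x y -> r y z -> r x z) ->
  (forall s m d, A m -> 0 < d -> half_nbhd s m d `<=` A ->
    exists2 d', 0 < d' & forall x, half_nbhd s m d' x -> r m x) ->
  forall a b, A a -> A b -> r a b.
Proof.
move=> iA rr rs rt loc a b.
wlog ab : a b / a < b.
  move=> H Aa Ab; have [ab|ba|->//] := ltgtP a b; first exact: H.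
  by apply: rs; apply: H.
move=> Aa Ab.
have cA y : a <= y <= b -> A y by move=> ?; exact: (iA _ _ Aa Ab).
pose S := [set y | a <= y <= b /\ r a y].
have Sa : S a by split => //; apply/andP; split => //; lra.
have ubS : ubound S b by move=> y [/andP[]].
have supS : has_sup S by split; [exists a | exists b].
pose m := sup S.
have ubm y : S y -> y <= m by exact: sup_upper_bound.
have am : a <= m by exact: ubm.
have mb : m <= b by apply: ge_sup => //; exists a.
have Am : A m by apply: cA; rewrite am.
have ram : r a m.
  have [->//|nam] := eqVneq a m.
  have ltam : a < m by rewrite lt_neqAle nam.
  (* Left of [m], all points within [d] are related to [m]. Some member of [S] is that close to its
     supremum and links [a] to [m]. *)
  have [||d d0 rm] := loc Minus m (m - a) Am; first lra.
    move=> y /=; rewrite in_itv /= => /andP[? ?].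
    by apply: cA; apply/andP; split; lra.
  have [y [aby ray] ym] := sup_adherent d0 supS.
  apply: (rt _ _ _ ray); apply/rs/rm => /=; rewrite in_itv /= ym /=.
  exact: ubm.
have [<-//|nmb] := eqVneq m b.
have ltmb : m < b by rewrite lt_neqAle nmb.
have [||d d0 rm] := loc Plus m (b - m) Am; first lra.
  move=> y /=; rewrite in_itv /= => /andP[? ?].
  by apply: cA; apply/andP; split; lra.
(* The step [e] must be strictly below [d], since the half-neighborhood is open at its far end, and
   [m + e] must not pass [b]. Then [m + e] is in [S], beyond its supremum. *)
pose e := Num.min (d / 2) (b - m).
have [ed eb] : e <= d / 2 /\ e <= b - m.
  by split; rewrite /e ge_min lexx ?orbT.
have e0 : 0 < e by rewrite lt_min; apply/andP; split; lra.
have : S (m + e).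
  split; first by apply/andP; split; lra.
  by apply: (rt _ _ _ ram); apply: rm => /=; rewrite in_itv /=; apply/andP; split; lra.
by move=> /ubm ?; exfalso; lra.
Qed.

End Sides.

Section DoubleContinuity.
Context {R : realType}.
Implicit Types (s t : sign) (f : double_function R) (I : set (R * R)).

Lemma double_continuous_at_signed s t f (a : R * R) :
  double_continuous_at f a -> signed_double_continuous_at s t f a.
Proof.
move=> [J1 [J2 [[[_ oJ1] [_ oJ2] [/= Ja1 Ja2] Jf] [c1 c2]]]].
have /nbhs_ballP[d1 /= d10 dJ1] : nbhs a.1 J1 by exact: open_nbhs_nbhs.
have /nbhs_ballP[d2 /= d20 dJ2] : nbhs a.2 J2 by exact: open_nbhs_nbhs.
have sub1 x : half_nbhd s a.1 d1 x -> J1 x by move/half_nbhd_ball/dJ1.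
have sub2 x : half_nbhd t a.2 d2 x -> J2 x by move/half_nbhd_ball/dJ2.
exists (d1, d2); split; [split=> //|split].
- by move=> x [/= /sub1 ? /sub2 ?]; apply: Jf.
- move=> x /= /sub1 /c1 c; apply: cvg_trans c.
  exact/cvg_app/at_side_dnbhs.
- move=> x /= /sub2 /c2 c; apply: cvg_trans c.
  exact/cvg_app/at_side_dnbhs.
Qed.

(** Removes the distinction between interior and boundary points: at an interior point, the
    one-sided limits follow from the two-sided ones. *)
Lemma double_continuous_on_signed s t I f (p d : R * R) :
  double_continuous_on I f -> 0 < d.1 -> 0 < d.2 -> quadrant s t p d `<=` I ->
  signed_double_continuous_at s t f p.
Proof.
move=> [int bd] d10 d20 dI.
have Ip : I p by apply: dI; split; exact: half_nbhd_center.
have [/int/double_continuous_at_signed //|np] := pselect (interior I p).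
apply: bd => //; last by exists d.
by split => //; exact: subset_closure.
Qed.

(** With the side [t] of [e] fixed, the local hypothesis is the one that [interval_one_class] asks
    for on [I1]. The function [g] is arbitrary so that the lemma also applies after the coordinates
    are exchanged. *)
Lemma ddiff_cvg_within (g : R * R -> R) (I1 I2 : set R) :
  is_interval I1 -> is_interval I2 ->
  (forall s t m e d1 d2, 0 < d1 -> 0 < d2 ->
    half_nbhd s m d1 `<=` I1 -> half_nbhd t e d2 `<=` I2 ->
    exists2 d, 0 < d & forall x, half_nbhd s m d x ->
      ddiff g (m, e) (x, y) @[y --> at_side t e] --> (0 : R)) ->
  forall c d e, I1 c -> I1 d -> I2 e ->
    ddiff g (d, e) (c, y) @[y --> within I2 e^'] --> (0 : R).
Proof.
move=> iI1 iI2 loc c d e I1c I1d I2e P P0.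
apply: within_dnbhs_sides => // t d2 d20 d2I.
(* The goal concerns one neighborhood [P] of 0. Transitivity needs the full limit, which lets two
   terms be added. *)
suff : ddiff g (d, e) (c, y) @[y --> at_side t e] --> (0 : R) by exact.
apply: (interval_one_class I1
  (fun d c => ddiff g (d, e) (c, y) @[y --> at_side t e] --> (0 : R))) => //.
- move=> x; rewrite (_ : (fun _ => _) = cst 0); first exact: cvg_cst.
  by apply/funext => y; rewrite /ddiff /=; ring.
- move=> x y xy; rewrite (_ : (fun _ => _) = (fun z => - ddiff g (x, e) (y, z))).
    by rewrite -oppr0; exact: cvgN.
  by apply/funext => z; rewrite /ddiff /=; ring.
- move=> x y z xy yz.
  rewrite (_ : (fun _ => _) =
      (fun u => ddiff g (x, e) (y, u) + ddiff g (y, e) (z, u))).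
    by rewrite -(addr0 0); exact: cvgD.
  by apply/funext => u; rewrite /ddiff /=; ring.
- by move=> s m d1 _ d10 d1I; exact: (loc s t m e d1 d2).
Qed.

Lemma globally_double_continuous_on_signed s t (I1 I2 : set R) f (p d : R * R) :
  globally_double_continuous_on I1 I2 f -> I1 `*` I2 `<=` dom f ->
  0 < d.1 -> 0 < d.2 -> quadrant s t p d `<=` I1 `*` I2 ->
  signed_double_continuous_at s t f p.
Proof.
move=> [g1 g2] If d10 d20 dI.
have p1 := half_nbhd_center s p.1 d.1 d10.
have p2 := half_nbhd_center t p.2 d.2 d20.
have sub1 : half_nbhd s p.1 d.1 `<=` I1 by move=> x xd; have [] := dI (x, p.2).
have sub2 : half_nbhd t p.2 d.2 `<=` I2 by move=> x xd; have [] := dI (p.1, x).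
exists d; split; [split=> //; exact: subset_trans If|split].
- move=> x /sub1 I1x.
  apply: cvg_trans (g1 x p.1 p.2 I1x (sub1 _ p1) (sub2 _ p2)).
  exact/cvg_app/(at_side_within t p.2 d.2).
- move=> x /sub2 I2x.
  apply: cvg_trans (g2 x p.2 p.1 I2x (sub2 _ p2) (sub1 _ p1)).
  exact/cvg_app/(at_side_within s p.1 d.1).
Qed.

(** Each coordinate of an interior point of the product is interior to its factor. Balls inside the
    factors serve as [J1] and [J2], and limits along [I1] and [I2] become ordinary punctured
    limits. *)
Lemma globally_double_continuous_on_at (I1 I2 : set R) f (p : R * R) :
  globally_double_continuous_on I1 I2 f -> I1 `*` I2 `<=` dom f ->
  interior (I1 `*` I2) p -> double_continuous_at f p.
Proof.
move=> [g1 g2] If [[A B] /= [pA pB] AB].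
have I1p : I1 p.1 by have [] := AB p (conj (nbhs_singleton pA) (nbhs_singleton pB)).
have I2p : I2 p.2 by have [] := AB p (conj (nbhs_singleton pA) (nbhs_singleton pB)).
have n1 : nbhs p.1 I1.
  by apply: filterS pA => x Ax; have [] := AB (x, p.2) (conj Ax (nbhs_singleton pB)).
have n2 : nbhs p.2 I2.
  by apply: filterS pB => x Bx; have [] := AB (p.1, x) (conj (nbhs_singleton pA) Bx).
have [d1 /= d10 sub1] := (nbhs_ballP p.1 I1).1 n1.
have [d2 /= d20 sub2] := (nbhs_ballP p.2 I2).1 n2.
have oball (x e : R) : open_interval (ball x e).
  by rewrite /open_interval ball_itv; split; [exact: interval_is_interval|exact: itv_open].
exists (ball p.1 d1), (ball p.2 d2); split; [split=> //|split].
- by split; exact: ballxx.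
- by move=> x [/sub1 ? /sub2 ?]; apply: If.
- move=> x /sub1 I1x.
  by apply: cvg_trans (g1 x p.1 p.2 I1x I1p I2p); exact/cvg_app/dnbhs_within.
- move=> x /sub2 I2x.
  by apply: cvg_trans (g2 x p.2 p.1 I2x I2p I1p); exact/cvg_app/dnbhs_within.
Qed.

End DoubleContinuity.

Theorem proposition7 (R : realType) (I1 I2 : set R) (f : double_function R)
    (hI1 : nondegenerate_interval I1) (hI2 : nondegenerate_interval I2)
    (hI : I1 `*` I2 `<=` dom f) :
  double_continuous_on (I1 `*` I2) f <-> globally_double_continuous_on I1 I2 f.
Proof.
have [iI1 _] := hI1; have [iI2 _] := hI2.
split=> [cf|gf]; last first.
  split=> [p|p _ _ s t [d [d10 d20 dI]]].
    exact: globally_double_continuous_on_at.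
  exact: globally_double_continuous_on_signed gf hI d10 d20 dI.
have signed s t m e d1 d2 : 0 < d1 -> 0 < d2 -> half_nbhd s m d1 `<=` I1 ->
    half_nbhd t e d2 `<=` I2 -> signed_double_continuous_at s t f (m, e).
  move=> d10 d20 dI1 dI2.
  by apply: (double_continuous_on_signed s t _ _ _ (d1, d2) cf) => //; move=> x [/dI1 ? /dI2 ?].
split; first apply: ddiff_cvg_within => // s t m e d1 d2 d10 d20 dI1 dI2.
  have [d [[d0 _ _] [c _]]] := signed s t m e d1 d2 d10 d20 dI1 dI2.
  by exists d.1.
(* The limit in the first variable is reduced to [ddiff_cvg_within] for [f \o swap], with [I1] and
   [I2] exchanged. Swapping coordinates only makes the two mixed terms of the double difference
   trade places. *)
pose swap (a : R * R) := (a.2, a.1).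
have swapE a b : ddiff (f \o swap) a b = ddiff f (swap a) (swap b).
  by rewrite /ddiff /=; ring.
move=> c d e I2c I2d I1e.
under eq_fun do rewrite -[ddiff _ _ _](swapE (d, e) (c, _)).
apply: (ddiff_cvg_within _ I2 I1) => // {c d e I2c I2d I1e}.
move=> t s m e d2 d1 d20 d10 dI2 dI1.
have [d [[_ d0 _] [_ c]]] := signed s t e m d1 d2 d10 d20 dI1 dI2.
exists d.2 => // x /c; apply: cvg_trans.
rewrite (_ : (fun _ => _) = fun y => ddiff f (e, m) (y, x)) //.
by apply/funext => y; rewrite swapE.
Qed.
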